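(* $\langle\vee\forall\rangle\not\le_{\sf m}\langle\forall\forall^\infty\forall\rangle$.
   Context: Quantifiers range over $\omega$. $\exists^\infty n\,\varphi(n)$ means $\forall m\exists n\ge m\,\varphi(n)$ and $\forall^\infty n\,\varphi(n)$ means $\exists m\forall n\ge m\,\varphi(n)$. Formulas considered are $\varphi(\bar x)\equiv\mathsf Q_0n_0\dots\mathsf Q_\ell n_\ell\,\theta(n_0,\dots,n_\ell,\bar x)$ with $\mathsf Q_i\in\{\exists,\forall,\exists^\infty,\forall^\infty\}$ and $\theta$ bounded. The instance $\bar x$ is a tuple of natural numbers and/or total computable functions (computable elements of $\omega^\omega$). Spaces such as $\omega\times\omega^\omega$, $(\omega^\omega)^\omega$, $\omega^{\omega\times\omega}$ are identified with $\omega^\omega$ by computable pairing. Witnesses: for $\alpha\in\omega^\omega$, $\alpha\Vdash\varphi(\bar x)$ (''$\alpha$ is a witness for $\varphi(\bar x)$'') is defined by: $\alpha\Vdash\theta(\bar x)$ iff $\alpha=\bar x$ and $\theta(\bar x)$, for bounded $\theta$; $\langle t,\alpha\rangle\Vdash\exists n\varphi(n,\bar x)$ iff $\alpha\Vdash\varphi(t,\bar x)$; $\alpha\Vdash\forall n\varphi(n,\bar x)$ iff $\alpha(n)\Vdash\varphi(n,\bar x)$ for all $n$; $\langle t,\alpha\rangle\Vdash\forall^\infty n\varphi(n,\bar x)$ iff $\alpha(n)\Vdash\varphi(n,\bar x)$ for all $n\ge t$; $\alpha\Vdash\exists^\infty n\varphi(n,\bar x)$ iff for all $n$, writing $\alpha(n)=\langle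 k,\beta\rangle$, $k\ge n$ and $\beta\Vdash\varphi(k,\bar x)$. $\varphi\le_{\sf m}\psi$ if there are computable functions $\eta,r_-,r_+$ (type-two computable functionals, possibly partial but defined wherever required) such that for every instance $\bar x$: $\varphi(\bar x)$ is true iff $\psi(\eta(\bar x))$ is true; $\alpha\Vdash\varphi(\bar x)$ implies $r_-(\alpha,\bar x)\Vdash\psi(\eta(\bar x))$; $\alpha\Vdash\psi(\eta(\bar x))$ implies $r_+(\alpha,\bar x)\Vdash\varphi(\bar x)$ ($\alpha\in\omega^\omega$ arbitrary). $\langle\forall\forall^\infty\forall\rangle$ is a fixed complete formula of its pattern (every formula with that pattern is $\le_{\sf m}$-reducible to it), concretely $\langle\forall\forall^\infty\forall\rangle(x)\equiv\forall n\,\forall^\infty t\,\forall k.\ x(n,t,k)=0$. The formula $\langle\vee\forall\rangle$ is, for $x=(x_0,x_1)$ with $x_0,x_1\in\omega^\omega$ computable, $x_0=0^\infty\vee x_1=0^\infty$, read as $\exists i\in\{0,1\}\,\forall t.\ x_i(t)=0$; so a witness is essentially an $i\in\{0,1\}$ with $x_i=0^\infty$, where $0^\infty$ is the constantly zero sequence. *)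

(* Defs.v *)
From Stdlib Require Import Arith List.
From Stdlib Require Cantor.
Import ListNotations.

(** * Baire space and its pairings *)

Definition baire : Type := nat -> nat.

Definition zero_seq : baire := fun _ => 0.

(* The pair (t, alpha), from nat * baire to baire: t in front of alpha. *)
Definition cons_seq (t : nat) (a : baire) : baire :=
  fun k => match k with 0 => t | S k' => a k' end.

Definition first (a : baire) : nat := a 0.
Definition rest (a : baire) : baire := fun k => a (S k).

(* The pair (alpha, beta), from baire * baire to baire: alpha on the even
   positions, beta on the odd ones. *)
Definition join (a b : baire) : baire :=
  fun k => if Nat.even k then a (Nat.div2 k) else b (Nat.div2 k).

(* alpha(n) when alpha is read as an element of baire^nat. *)
Definition column (a : baire) (n : nat) : baire :=
  fun k => a (Cantor.to_nat (n, k)).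

(** * Computability

    Kleene-style codes for the functions that are partial recursive in an
    oracle p.  All functions are unary, and several arguments are passed through
    Cantor pairing.  [eval p c n m] says that the computation of c on input n
    with oracle p halts with output m. *)

Inductive code : Set :=
| c_zero
| c_succ
| c_fst
| c_snd
| c_oracle
| c_pair (f g : code)
| c_comp (f g : code)
| c_prec (f g : code)
| c_mu (f : code).

Inductive eval (p : baire) : code -> nat -> nat -> Prop :=
| eval_zero n : eval p c_zero n 0
| eval_succ n : eval p c_succ n (S n)
| eval_fst n : eval p c_fst n (fst (Cantor.of_nat n))
| eval_snd n : eval p c_snd n (snd (Cantor.of_nat n))
| eval_oracle n : eval p c_oracle n (p n)
| eval_pair f g n a b :
    eval p f n a -> eval p g n b ->
    eval p (c_pair f g) n (Cantor.to_nat (a, b))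
| eval_comp f g n m r :
    eval p g n m -> eval p f m r -> eval p (c_comp f g) n r
| eval_prec_0 f g a r :
    eval p f a r -> eval p (c_prec f g) (Cantor.to_nat (a, 0)) r
| eval_prec_S f g a k i r :
    eval p (c_prec f g) (Cantor.to_nat (a, k)) i ->
    eval p g (Cantor.to_nat (a, Cantor.to_nat (k, i))) r ->
    eval p (c_prec f g) (Cantor.to_nat (a, S k)) r
(* k is the least zero of f(n, -); the values h j + 1 at all j < k must be
   defined. *)
| eval_mu f n k (h : nat -> nat) :
    (forall j, j < k -> eval p f (Cantor.to_nat (n, j)) (S (h j))) ->
    eval p f (Cantor.to_nat (n, k)) 0 ->
    eval p (c_mu f) n k.

Definition computable (f : baire) : Prop :=
  exists c, forall n, eval zero_seq c n (f n).

(* The partial computable functional with code c is defined at p, with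
   value q. *)
Definition maps (c : code) (p q : baire) : Prop :=
  forall n, eval p c n (q n).

(** * Tuples of numbers and functions *)

Record tuple : Type := Tuple { nums : list nat; funs : list baire }.

Definition push (n : nat) (x : tuple) : tuple := Tuple (n :: nums x) (funs x).

Fixpoint join_all (fs : list baire) : baire :=
  match fs with
  | [] => zero_seq
  | [f] => f
  | f :: fs' => join f (join_all fs')
  end.

(* The element of Baire space that codes a tuple; it determines the tuple once
   the numbers of components are fixed. *)
Definition encode (x : tuple) : baire :=
  fold_right cons_seq (join_all (funs x)) (nums x).

(** * Formulas

    [t_var i] is the i-th number and [t_app i t] is the i-th function, applied
    to t, of the tuple at which a term is evaluated.  Quantifiers put their
    variable in front of the numbers of the tuple, so the innermost bound
    variable is [t_var 0].  Functions of several arguments are functions of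
    one argument through [t_pair]. *)

Inductive term : Set :=
| t_var (i : nat)
| t_zero
| t_succ (t : term)
| t_add (s t : term)
| t_mul (s t : term)
| t_pair (s t : term)
| t_app (i : nat) (t : term).

Inductive bounded : Set :=
| b_eq (s t : term)
| b_le (s t : term)
| b_not (a : bounded)
| b_and (a b : bounded)
| b_or (a b : bounded)
| b_all (bound : term) (a : bounded)
| b_ex (bound : term) (a : bounded).

Fixpoint tval (t : term) (x : tuple) : nat :=
  match t with
  | t_var i => nth i (nums x) 0
  | t_zero => 0
  | t_succ t => S (tval t x)
  | t_add s t => tval s x + tval t x
  | t_mul s t => tval s x * tval t x
  | t_pair s t => Cantor.to_nat (tval s x, tval t x)
  | t_app i t => nth i (funs x) zero_seq (tval t x)
  end.

Fixpoint bholds (a : bounded) (x : tuple) : Prop :=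
  match a with
  | b_eq s t => tval s x = tval t x
  | b_le s t => tval s x <= tval t x
  | b_not a => ~ bholds a x
  | b_and a b => bholds a x /\ bholds b x
  | b_or a b => bholds a x \/ bholds b x
  | b_all s a => forall n, n < tval s x -> bholds a (push n x)
  | b_ex s a => exists n, n < tval s x /\ bholds a (push n x)
  end.

(* [q_inf]: there are infinitely many; [q_ae]: for all but finitely many. *)
Inductive quantifier : Set := q_ex | q_all | q_inf | q_ae.

(* The formula  prefix. matrix  in [num_arity] number parameters and
   [fun_arity] function parameters. *)
Record formula : Type := Formula {
  num_arity : nat;
  fun_arity : nat;
  prefix : list quantifier;
  matrix : bounded
}.

Definition is_instance (phi : formula) (x : tuple) : Prop :=
  length (nums x) = num_arity phi /\
  length (funs x) = fun_arity phi /\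
  Forall computable (funs x).

Fixpoint prefix_holds (qs : list quantifier) (theta : bounded) (x : tuple)
  : Prop :=
  match qs with
  | [] => bholds theta x
  | q_ex :: qs => exists n, prefix_holds qs theta (push n x)
  | q_all :: qs => forall n, prefix_holds qs theta (push n x)
  | q_inf :: qs => forall m, exists n, m <= n /\ prefix_holds qs theta (push n x)
  | q_ae :: qs => exists m, forall n, m <= n -> prefix_holds qs theta (push n x)
  end.

Definition holds (phi : formula) (x : tuple) : Prop :=
  prefix_holds (prefix phi) (matrix phi) x.

Fixpoint prefix_witness (qs : list quantifier) (theta : bounded)
    (a : baire) (x : tuple) : Prop :=
  match qs with
  | [] => (forall k, a k = encode x k) /\ bholds theta x
  | q_ex :: qs => prefix_witness qs theta (rest a) (push (first a) x)
  | q_all :: qs =>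
      forall n, prefix_witness qs theta (column a n) (push n x)
  | q_inf :: qs =>
      forall n, n <= first (column a n) /\
        prefix_witness qs theta (rest (column a n))
          (push (first (column a n)) x)
  | q_ae :: qs =>
      forall n, first a <= n ->
        prefix_witness qs theta (column (rest a) n) (push n x)
  end.

Definition witness (a : baire) (phi : formula) (x : tuple) : Prop :=
  prefix_witness (prefix phi) (matrix phi) a x.

(** * Many-one reducibility *)

(* [y] is the instance eta(x) of psi. *)
Definition reducible (phi psi : formula) : Prop :=
  exists eta r_minus r_plus : code,
  forall x, is_instance phi x ->
  exists y, is_instance psi y /\
    maps eta (encode x) (encode y) /\
    (holds phi x <-> holds psi y) /\
    (forall a, witness a phi x ->
       exists b, maps r_minus (join a (encode x)) b /\ witness b psi y) /\
    (forall a, witness a psi y ->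
       exists b, maps r_plus (join a (encode x)) b /\ witness b phi x).

(** * The two formulas *)

(* forall n, for almost all t, forall k, x(n, t, k) = 0. *)
Definition all_ae_all : formula :=
  Formula 0 1 [q_all; q_ae; q_all]
    (b_eq (t_app 0 (t_pair (t_var 2) (t_pair (t_var 1) (t_var 0)))) t_zero).

(* exists i in {0, 1}, forall t, x_i(t) = 0. *)
Definition or_all : formula :=
  Formula 0 2 [q_ex; q_all]
    (b_or
       (b_and (b_eq (t_var 1) t_zero) (b_eq (t_app 0 (t_var 0)) t_zero))
       (b_and (b_eq (t_var 1) (t_succ t_zero))
          (b_eq (t_app 1 (t_var 0)) t_zero))).

(* Main.v *)
Require Import Defs.
From Stdlib Require Import Arith Lia.
From Stdlib Require Cantor List.
Import List.ListNotations.

(** Let x = (0^oo, 0^oo), with image y.  The functional r_- turns the two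
    witnesses 0 and 1 of x into witnesses of y, whose bounds are g_0 and g_1.
    The witnesses of y are closed under increasing the bounds, so
    g = max(g_0, g_1) gives a witness as well, and r_+ reads off from it an
    answer i after inspecting finite parts of g, x and y.  Now make x_i
    nonzero at a late position.  The witness 1 - i remains valid, and by
    continuity r_- sends it to bounds that agree with g_{1-i} on a long initial
    segment; their maximum with g_i is a witness on which r_+ still answers i,
    which has become wrong. *)

(** * Determinism and continuity of oracle computations *)

Lemma eval_prec_inv p f g a k r :
  eval p (c_prec f g) (Cantor.to_nat (a, k)) r ->
  match k with
  | 0 => eval p f a r
  | S k' => exists i,
      eval p (c_prec f g) (Cantor.to_nat (a, k')) i /\
      eval p g (Cantor.to_nat (a, Cantor.to_nat (k', i))) r
  end.
Proof.
  (* The input is a Cantor code, not a constructor term, so injectivity of pairing has to tell which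
     rule applied. *)
  remember (c_prec f g) as c eqn:Ec.
  remember (Cantor.to_nat (a, k)) as m eqn:Em.
  destruct 1; try discriminate; apply Cantor.to_nat_inj in Em;
    injection Ec; injection Em; intros; subst; eauto.
Qed.

Lemma eval_functional p c n r r' : eval p c n r -> eval p c n r' -> r = r'.
Proof.
  intros H; revert r'.
  induction H as [n|n|n|n|n|f g n a b _ IHf _ IHg|f g n m r _ IHg _ IHf
                 |f g a r _ IHf|f g a k i r _ IHi _ IHg|f n k h _ IHlt _ IHk];
    intros r' H'.
  8: now apply eval_prec_inv in H'; apply IHf.
  8: { apply eval_prec_inv in H'; destruct H' as (i' & Hi & Hg).
       apply IHi in Hi; subst i'; now apply IHg. }
  all: inversion H'; subst; auto.
  - f_equal; f_equal; auto.
  - apply IHf. erewrite IHg; eassumption.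
  (* If the two least zeros differed, [f] would take both the value 0 and a successor at the smaller
     one. *)
  - destruct (Nat.lt_trichotomy k r') as [L|[L|L]]; auto; exfalso.
    + match goal with E : forall j, j < r' -> _ |- _ =>
        discriminate (IHk _ (E k L)) end.
    + match goal with E : eval _ _ (Cantor.to_nat (n, r')) 0 |- _ =>
        discriminate (IHlt r' L _ E) end.
Qed.

Definition agree (N : nat) (p q : baire) : Prop :=
  forall n, n < N -> p n = q n.

Lemma agree_le M N p q : M <= N -> agree N p q -> agree M p q.
Proof. intros L H n Hn; apply H; lia. Qed.

Lemma uniform_bound (P : nat -> nat -> Prop) N :
  (forall n M M', M <= M' -> P n M -> P n M') ->
  (forall n, n < N -> exists M, P n M) ->
  exists M, forall n, n < N -> P n M.
Proof.
  intros Pmono; induction N as [|N IH]; intros H.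
  - exists 0; intros n Hn; lia.
  - destruct IH as [M HM]; [intros n Hn; apply H; lia|].
    destruct (H N) as [M' HM']; [lia|].
    exists (max M M'); intros n Hn.
    destruct (Nat.eq_dec n N) as [->|D].
    + apply (Pmono _ M'); [lia|assumption].
    + apply (Pmono _ M); [lia|apply HM; lia].
Qed.

(** A halting computation is a finite derivation and queries the oracle finitely often; [M] exceeds
    every query. *)
Lemma eval_use p c n r :
  eval p c n r -> exists M, forall q, agree M p q -> eval q c n r.
Proof.
  intros H.
  induction H as [n|n|n|n|n|f g n a b _ [M IHf] _ [M' IHg]
                 |f g n m r _ [M IHg] _ [M' IHf]
                 |f g a r _ [M IHf]|f g a k i r _ [M IHi] _ [M' IHg]
                 |f n k h _ IHlt _ [M IHk]].
  1-4: exists 0; intros; constructor.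
  - exists (S n); intros q Hq. rewrite (Hq n) by lia. constructor.
  - exists (max M M'); intros q Hq.
    constructor; [apply IHf|apply IHg]; (eapply agree_le; [|exact Hq]); lia.
  - exists (max M M'); intros q Hq.
    apply eval_comp with m; [apply IHg|apply IHf];
      (eapply agree_le; [|exact Hq]); lia.
  - exists M; intros q Hq; constructor; auto.
  - exists (max M M'); intros q Hq.
    apply eval_prec_S with i; [apply IHi|apply IHg];
      (eapply agree_le; [|exact Hq]); lia.
  (* Each test at [j < k] has its own modulus; there are finitely many, so one modulus serves
     all. *)
  - apply uniform_bound in IHlt.
    + destruct IHlt as [M' IHlt].
      exists (max M M'); intros q Hq.
      apply eval_mu with h.
      * intros j Hj; apply IHlt; [assumption|].
        eapply agree_le; [|exact Hq]; lia.
      * apply IHk. eapply agree_le; [|exact Hq]; lia.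
    + intros j K K' L HK q Hq; apply HK; eapply agree_le; eassumption.
Qed.

Lemma maps_continuous c p q N :
  maps c p q ->
  exists M, forall p' q', agree M p p' -> maps c p' q' -> agree N q q'.
Proof.
  intros H.
  destruct (uniform_bound
    (fun n M => forall p', agree M p p' -> eval p' c n (q n)) N) as [M HM].
  - intros n M M' L HM p' Hp; apply HM; eapply agree_le; eassumption.
  - intros n _; apply eval_use, H.
  - exists M; intros p' q' Hp Hm n Hn.
    eapply eval_functional; [apply HM; eassumption|apply Hm].
Qed.

(** * Canonical witnesses as continuous functions of their data *)

Lemma agree_join N p p' q q' :
  agree N p p' -> agree N q q' -> agree N (join p q) (join p' q').
Proof.
  intros Hp Hq n Hn; unfold join.
  assert (Nat.div2 n <= n) by (apply Nat.div2_decr; lia).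
  destruct (Nat.even n); [apply Hp|apply Hq]; lia.
Qed.

Lemma agree_cons N t p q : agree N p q -> agree N (cons_seq t p) (cons_seq t q).
Proof. intros H [|n] Hn; cbn; [reflexivity|apply H; lia]. Qed.

Definition assemble (F : nat -> baire) : baire :=
  fun j => F (fst (Cantor.of_nat j)) (snd (Cantor.of_nat j)).

Lemma column_assemble F n k : column (assemble F) n k = F n k.
Proof. unfold column, assemble; now rewrite Cantor.cancel_of_to. Qed.

(** A Cantor code is at least as large as both its components, so entries below [N] only involve
    rows and positions below [N]. *)
Lemma agree_assemble N F G :
  (forall n, n < N -> agree N (F n) (G n)) -> agree N (assemble F) (assemble G).
Proof.
  intros H j Hj; unfold assemble.
  pose proof (Cantor.to_nat_non_decreasing
    (fst (Cantor.of_nat j)) (snd (Cantor.of_nat j))) as L.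
  rewrite <- surjective_pairing, Cantor.cancel_to_of in L.
  apply H; lia.
Qed.

(** At the matrix a witness must be the code of the whole tuple, innermost variable first; hence
    [n], then [j], then the code [e] of the instance. *)
Definition or_witness (j : nat) (e : baire) : baire :=
  cons_seq j (assemble (fun n => cons_seq n (cons_seq j e))).

Lemma agree_or_witness N j e e' :
  agree N e e' -> agree N (or_witness j e) (or_witness j e').
Proof.
  intros H; apply agree_cons, agree_assemble; intros n _.
  now apply agree_cons, agree_cons.
Qed.

Lemma or_witness_correct j u v :
  (forall n, (j = 0 /\ u n = 0) \/ (j = 1 /\ v n = 0)) ->
  witness (or_witness j (encode (Tuple [] [u; v]))) or_all (Tuple [] [u; v]).
Proof.
  intros H n; split.
  - intros k. exact (column_assemble
      (fun n => encode (push n (push j (Tuple [] [u; v])))) n k).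
  - exact (H n).
Qed.

Lemma or_witness_inv b u v :
  witness b or_all (Tuple [] [u; v]) ->
  forall n, (first b = 0 /\ u n = 0) \/ (first b = 1 /\ v n = 0).
Proof. intros H n. exact (proj2 (H n)). Qed.

(* A witness is unconstrained below its bounds g; giving it there the same form
   as above them makes it a continuous function of g and of the code e of the
   instance. *)
Definition ae_witness (g : nat -> nat) (e : baire) : baire :=
  assemble (fun n => cons_seq (g n)
    (assemble (fun t => assemble (fun k => cons_seq k (cons_seq t (cons_seq n e)))))).

Lemma agree_ae_witness N g g' e e' :
  agree N g g' -> agree N e e' -> agree N (ae_witness g e) (ae_witness g' e').
Proof.
  intros Hg He; apply agree_assemble; intros n Hn.
  rewrite (Hg n Hn).
  apply agree_cons, agree_assemble; intros t _.
  apply agree_assemble; intros k _.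
  now repeat apply agree_cons.
Qed.

Definition bounds (b : baire) (n : nat) : nat := first (column b n).

Lemma agree_bounds b N :
  exists M, forall b', agree M b b' -> agree N (bounds b) (bounds b').
Proof.
  destruct (uniform_bound (fun n M => Cantor.to_nat (n, 0) < M) N) as [M HM].
  - intros; lia.
  - intros n _; exists (S (Cantor.to_nat (n, 0))); lia.
  - exists M; intros b' H n Hn. exact (H _ (HM n Hn)).
Qed.

(** Any [t] above [g n] is above the bound of [b], which supplies the truth of the matrix there; the
    remaining entries are the codes of the tuples. *)
Lemma ae_witness_correct y b g :
  witness b all_ae_all y ->
  (forall n, bounds b n <= g n) ->
  witness (ae_witness g (encode y)) all_ae_all y.
Proof.
  intros Hb Hg n t Ht k.
  assert (L : first (column b n) <= t).
  { etransitivity; [apply Hg|]. etransitivity; [|exact Ht].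
    unfold first, ae_witness; rewrite column_assemble; apply le_n. }
  destruct (Hb n t L k) as [_ Hholds]; split; [|exact Hholds].
  intros l.
  (* The successor skips the bound stored at position 0 of the column. *)
  change (column (ae_witness g (encode y)) n
    (S (Cantor.to_nat (t, Cantor.to_nat (k, l))))
    = encode (push k (push t (push n y))) l).
  unfold ae_witness; rewrite column_assemble.
  etransitivity; [exact (column_assemble
    (fun t => assemble (fun k => encode (push k (push t (push n y))))) t (Cantor.to_nat (k, l)))|].
  exact (column_assemble (fun k => encode (push k (push t (push n y)))) k l).
Qed.

(** * Stability of the answer under small changes of the instance *)

Definition reduces_at (eta r_minus r_plus : code) (phi psi : formula) (x : tuple)
  : Prop :=
  exists y, is_instance psi y /\
    maps eta (encode x) (encode y) /\
    (holds phi x <-> holds psi y) /\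
    (forall a, witness a phi x ->
       exists b, maps r_minus (join a (encode x)) b /\ witness b psi y) /\
    (forall a, witness a psi y ->
       exists b, maps r_plus (join a (encode x)) b /\ witness b phi x).

(** The bounds [h] stay frozen while those coming from witness [j] follow [x']. The maximum
    dominates the latter, hence is a witness for the new image, and it varies continuously with
    [x']. *)
Lemma answer_locally_constant eta r_minus r_plus x y j a h g b :
  (forall x', is_instance or_all x' ->
     reduces_at eta r_minus r_plus or_all all_ae_all x') ->
  maps eta (encode x) (encode y) ->
  maps r_minus (join (or_witness j (encode x)) (encode x)) a ->
  (forall n, g n = max (bounds a n) (h n)) ->
  maps r_plus (join (ae_witness g (encode y)) (encode x)) b ->
  exists M, forall x', is_instance or_all x' ->
    agree M (encode x) (encode x') ->
    witness (or_witness j (encode x')) or_all x' ->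
    exists b', witness b' or_all x' /\ first b' = first b.
Proof.
  intros Hred Heta Hminus Hg Hplus.
  (* Moduli are chosen backwards from the answer, the single entry 0 of [b]: [N] for the oracle of
     [r_plus], [K] for the entries of [a] fixing its first [N] bounds, then [M1] and [M2] for the
     inputs of [r_minus] and [eta]. *)
  destruct (maps_continuous _ _ _ 1 Hplus) as [N HN].
  destruct (agree_bounds a N) as [K HK].
  destruct (maps_continuous _ _ _ K Hminus) as [M1 HM1].
  destruct (maps_continuous _ _ _ N Heta) as [M2 HM2].
  exists (max N (max M1 M2)); intros x' Hx' Hagree Hw.
  destruct (Hred x' Hx') as (y' & Hy' & Heta' & _ & Hminus' & Hplus').
  destruct (Hminus' _ Hw) as (a' & Ha' & Hwa').
  destruct (Hplus' (ae_witness (fun n => max (bounds a' n) (h n)) (encode y')))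
    as (b' & Hb' & Hwb').
  { apply ae_witness_correct with a'; auto; intros n; lia. }
  exists b'; split; [assumption|].
  symmetry. apply (HN _ _) with (2 := Hb'); [|lia].
  assert (Ha : agree K a a').
  { apply (HM1 _ _) with (2 := Ha').
    assert (agree M1 (encode x) (encode x'))
      by (eapply agree_le; [|exact Hagree]; lia).
    apply agree_join; [apply agree_or_witness|]; assumption. }
  apply agree_join; [apply agree_ae_witness|].
  - intros n Hn. rewrite Hg, (HK _ Ha n Hn). reflexivity.
  - apply (HM2 _ _) with (2 := Heta'). eapply agree_le; [|exact Hagree]; lia.
  - eapply agree_le; [|exact Hagree]; lia.
Qed.

(** * Computability of the instances *)

Lemma computable_zero : computable zero_seq.
Proof. exists c_zero; constructor. Qed.

Lemma computable_id : computable (fun n => n).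
Proof.
  exists (c_pair c_fst c_snd); intros n.
  rewrite <- (Cantor.cancel_to_of n) at 2.
  rewrite (surjective_pairing (Cantor.of_nat n)).
  repeat constructor.
Qed.

Lemma computable_pred f : computable f -> computable (fun n => pred (f n)).
Proof.
  intros [c Hc].
  (* Primitive recursion that starts at 0 and whose step returns the counter, ignoring the previous
     value; the parameter is a dummy 0. *)
  exists (c_comp (c_prec c_zero (c_comp c_fst c_snd)) (c_pair c_zero c)).
  intros n; apply eval_comp with (Cantor.to_nat (0, f n)).
  { repeat constructor; apply Hc. }
  generalize (f n) as m.
  induction m as [|m IH]; [repeat constructor|].
  eapply eval_prec_S; [exact IH|].
  eapply eval_comp; [constructor|].
  rewrite Cantor.cancel_of_to; cbn [snd].
  replace (pred (S m))
    with (fst (Cantor.of_nat (Cantor.to_nat (m, pred m))))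
    by now rewrite Cantor.cancel_of_to.
  constructor.
Qed.

(** Truncated subtraction provides the late change: zero up to [s], nonzero from [S s] on. *)
Lemma computable_sub s : computable (fun n => n - s).
Proof.
  induction s as [|s [c Hc]].
  - destruct computable_id as [c Hc]; exists c; intros n.
    rewrite Nat.sub_0_r; apply Hc.
  - destruct (computable_pred (fun n => n - s)) as [c' Hc']; [now exists c|].
    exists c'; intros n. rewrite Nat.sub_succ_r; apply Hc'.
Qed.

Lemma or_all_instance u v :
  computable u -> computable v -> is_instance or_all (Tuple [] [u; v]).
Proof. intros; repeat split; repeat constructor; assumption. Qed.

Lemma agree_zero_sub M : agree M zero_seq (fun n => n - M).
Proof. intros n Hn; unfold zero_seq; lia. Qed.

Lemma agree_refl M p : agree M p p.
Proof. intros n _; reflexivity. Qed.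

Theorem proposition4p11 : ~ reducible or_all all_ae_all.
Proof.
  intros (eta & r_minus & r_plus & Hred).
  pose (x := Tuple [] [zero_seq; zero_seq]).
  assert (Hx : is_instance or_all x)
    by (apply or_all_instance; apply computable_zero).
  destruct (Hred x Hx) as (y & Hy & Heta & _ & Hminus & Hplus).
  destruct (Hminus (or_witness 0 (encode x))) as (a0 & Ha0 & Hw0).
  { apply or_witness_correct; auto. }
  destruct (Hminus (or_witness 1 (encode x))) as (a1 & Ha1 & Hw1).
  { apply or_witness_correct; auto. }
  pose (g := fun n => max (bounds a0 n) (bounds a1 n)).
  destruct (Hplus (ae_witness g (encode y))) as (b & Hb & Hwb).
  { apply ae_witness_correct with a0; auto; intros n; unfold g; lia. }
  destruct (or_witness_inv _ _ _ Hwb 0) as [[Hi _]|[Hi _]].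
  (* The answer is 0, so [x_0] is changed: witness 1 survives and moves [a1], while the bounds of
     [a0] are frozen. *)
  - destruct (answer_locally_constant _ _ _ _ _ 1 _ (bounds a0) g _
      Hred Heta Ha1 (fun n => Nat.max_comm _ _) Hb) as [M HM].
    destruct (HM (Tuple [] [fun n => n - M; zero_seq])) as (b' & Hwb' & Hi').
    + apply or_all_instance; [apply computable_sub|apply computable_zero].
    + apply agree_join; [apply agree_zero_sub|apply agree_refl].
    + apply or_witness_correct; auto.
    (* The answer is still 0, but the changed component has value 1 at [S M]. *)
    + destruct (or_witness_inv _ _ _ Hwb' (S M)); lia.
  - destruct (answer_locally_constant _ _ _ _ _ 0 _ (bounds a1) g _
      Hred Heta Ha0 (fun n => eq_refl) Hb) as [M HM].
    destruct (HM (Tuple [] [zero_seq; fun n => n - M])) as (b' & Hwb' & Hi').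
    + apply or_all_instance; [apply computable_zero|apply computable_sub].
    + apply agree_join; [apply agree_refl|apply agree_zero_sub].
    + apply or_witness_correct; auto.
    + destruct (or_witness_inv _ _ _ Hwb' (S M)); lia.
Qed.
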